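(* Let $R$ be a real $N\times N$ matrix with (complex) eigenvalues $\lambda_1,\dots,\lambda_N$. Suppose that the spectral radius of $R$ is supported by a pair of conjugate eigenvalues $\lambda_1$ and $\lambda_2=\bar\lambda_1$, associated with (complex) eigenvectors $\zeta_1$ and $\zeta_2=\bar\zeta_1$, and that $|\lambda_1|=|\bar\lambda_1|>|\lambda_j|$ for all $j\ge 3$, where the eigenvalues are ordered so that $|\lambda_3|\ge|\lambda_j|$ for all $j\ge 3$. Let $(u_k)_{k\ge 0}$ be a sequence in $\mathbb R^N$ defined by $u_{k+1}=Ru_k$. Let $\theta_1$ be the argument of $\lambda_1$. Then for any Hilbertian norm $\|\cdot\|$ there exist real numbers $a$, $b$, $\varphi$ such that, with $$\phi(x)=|\lambda_1|^2\left(1+b\,\frac{\cos(2(x+1)\theta_1+\varphi)-\cos(2x\theta_1+\varphi)}{a+b\cos(2x\theta_1+\varphi)}\right),\qquad x\in\mathbb R,$$ we have $$\frac{\|u_{k+1}\|^2}{\|u_k\|^2}=\phi(k)+O\left(\left|\frac{\lambda_3}{\lambda_1}\right|^k\right)\quad (k\to+\infty).$$ Moreover, $\phi$ is periodic and, if $\underline x$ denotes one of its minimizers over $\mathbb R$ and $\bar x$ one of its maximizers over $\mathbb R$, then $$|\lambda_1|=\sqrt{\phi\left(\frac{\underline x+\bar x}{2}\right)}.$$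
   Context: A Hilbertian norm is a norm on $\mathbb R^N$ induced by an inner product. ''The spectral radius of $R$ is supported by a pair of conjugate eigenvalues'' means that the eigenvalues of maximal modulus of $R$ are exactly the non-real conjugate pair $\lambda_1,\bar\lambda_1$.
   Formalization: Two hypotheses are added, without which the claim fails: u_0 has a nonzero component along ζ_1 (and its conjugate) in the spectral decomposition, and every nonzero eigenvalue λ_j (j≥3) with |λ_j|=|λ_3| is semisimple (no nontrivial Jordan block). *)

(* Defs.v *)
From mathcomp Require Import all_boot all_order all_algebra.
From mathcomp Require Import sesquilinear complex.
From mathcomp Require Import all_classical all_reals all_analysis.

Set Implicit Arguments.
Unset Strict Implicit.
Unset Printing Implicit Defensive.

Import Order.TTheory GRing.Theory Num.Theory.
Import numFieldNormedType.Exports.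

Local Open Scope ring_scope.
Local Open Scope complex_scope.

Definition cplx_mx (R : realType) m n (A : 'M[R]_(m, n)) : 'M[R[i]]_(m, n) :=
  map_mx (real_complex R) A.

Definition conj_mx (R : realType) m n (A : 'M[R[i]]_(m, n)) :
  'M[R[i]]_(m, n) := map_mx (@conjc R) A.

Definition cmod (R : realType) (z : R[i]) : R := ComplexField.Normc.normc z.

Definition hilbertian_norm (R : realType) N (nrm : 'cV[R]_N -> R) : Prop :=
  exists ip : {dot 'cV[R]_N for idfun}, forall x, nrm x = Num.sqrt (ip x x).

(* Any real argument is allowed, not only the principal one. *)
Definition is_argument (R : realType) (z : R[i]) (theta : R) : Prop :=
  z = (cmod z * cos theta) +i* (cmod z * sin theta).

(* Below, [lam] lists all the eigenvalues of [A] with multiplicity, the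
   dominant conjugate pair being [lam`_0] and [lam`_1]; for N = 2 the
   out-of-range [lam`_2] reads as 0.  The kernel of the
   product is the sum of the generalized eigenspaces of the other eigenvalues,
   so [c] is the coordinate of [u] along [z] in the decomposition of C^N into
   that sum and the lines spanned by [z] and its conjugate. *)
Definition excites_dominant_pair (R : realType) N (A : 'M[R[i]]_N)
    (lam : seq R[i]) (z : 'cV[R[i]]_N) (u : 'cV[R]_N) : Prop :=
  exists (c : R[i]) (v : 'cV[R[i]]_N),
    [/\ c != 0,
        cplx_mx u = c *: z + c^* *: conj_mx z + v
      & (\prod_(2 <= j < N) (A - (lam`_j)%:M)) *m v = 0].

(* No Jordan block of size at least 2 for [mu]. *)
Definition semisimple_eigenvalue (R : realType) N (A : 'M[R[i]]_N)
    (mu : R[i]) : Prop :=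
  forall v : 'cV[R[i]]_N,
    (A - mu%:M) *m ((A - mu%:M) *m v) = 0 -> (A - mu%:M) *m v = 0.

Definition ratio_profile (R : realType) (rho theta a b vphi x : R) : R :=
  rho ^+ 2 *
    (1 + b * ((cos (2 * (x + 1) * theta + vphi) - cos (2 * x * theta + vphi))
              / (a + b * cos (2 * x * theta + vphi)))).

(* Main.v *)
(** Let c be the coordinate of u_0 along zeta and 2 c zeta = p + iq with p, q
    real, and let lambda_1 = rho e^(i theta).  Then u_k = rho^k (w_k + y_k),
    where w_k = cos(k theta) p - sin(k theta) q turns on an ellipse and
    y_k = O(|lambda_3/lambda_1|^k), because the nonzero eigenvalues of modulus
    |lambda_3| are semisimple.  The function 2 |w_k|^2 equals
    g(k) = a + b cos(2k theta + vphi), with |b| < a since p and q are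
    independent, and phi(x) = rho^2 g(x+1)/g(x).

    In the variable t = (2x+1) theta + vphi this profile is, up to rho^2,
    h(t) = (a + b cos(t+theta)) / (a + b cos(t-theta)), which satisfies
    h(-t) = 1/h(t) and, for b <> 0, has its critical points where
    a cos t + b cos(theta) = 0.  Hence a minimizer and a maximizer are opposite
    modulo 2 pi, their midpoint is a multiple of pi, and h equals 1 there. *)

Require Import Defs.
From mathcomp Require Import all_boot all_order all_algebra.
From mathcomp Require Import sesquilinear complex.
From mathcomp Require Import ring lra.
From mathcomp Require Import all_classical all_reals all_analysis.

Set Implicit Arguments.
Unset Strict Implicit.
Unset Printing Implicit Defensive.

Import Order.TTheory GRing.Theory Num.Theory.
Import numFieldNormedType.Exports.

Local Open Scope classical_set_scope.
Local Open Scope ring_scope.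
Local Open Scope complex_scope.

(** * Extrema and periodicity of the ratio profile *)

Lemma polar_coordinates (R : realType) (x y : R) :
  exists s t, [/\ 0 <= s, x = s * cos t & y = s * sin t].
Proof.
set s := Num.sqrt (x ^+ 2 + y ^+ 2).
have s2 : s ^+ 2 = x ^+ 2 + y ^+ 2 by rewrite sqr_sqrtr // addr_ge0 ?sqr_ge0.
have s_ge0 : 0 <= s by exact: sqrtr_ge0.
case: (eqVneq s 0) => [s0|s0].
  have : x ^+ 2 + y ^+ 2 == 0 by rewrite -s2 s0 expr0n.
  rewrite paddr_eq0 ?sqr_ge0 // !sqrf_eq0 => /andP[/eqP -> /eqP ->].
  by exists 0, 0; rewrite !mul0r.
have xs1 : (x / s) ^+ 2 + (y / s) ^+ 2 = 1.
  by rewrite !expr_div_n -mulrDl -s2 divff // sqrf_eq0.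
have xs : -1 <= x / s <= 1 by apply/andP; split; nra.
have sqrt_xs : Num.sqrt (1 - (x / s) ^+ 2) = `|y / s|.
  by rewrite -xs1 addrC addKr sqrtr_sqr.
have [y_ge0|y_lt0] := leP 0 (y / s).
  exists s, (acos (x / s)); split=> //.
    by rewrite acosK // mulrC divfK.
  by rewrite sin_acos // sqrt_xs ger0_norm // mulrC divfK.
exists s, (- acos (x / s)); split=> //.
  by rewrite cosN acosK // mulrC divfK.
by rewrite sinN sin_acos // sqrt_xs ltr0_norm // opprK mulrC divfK.
Qed.

(** Equality case of Cauchy-Schwarz: writing (A, B) = s (cos t, sin t) with s > 0, maximality
    against this t forces cos (t - t0) >= 1, and Lagrange's identity then kills sin (t0 - t). *)
Lemma sinusoid_max (R : realType) (A B t0 : R) :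
  (forall t, A * cos t + B * sin t <= A * cos t0 + B * sin t0) ->
  A * sin t0 = B * cos t0.
Proof.
move=> t0_max; have [s [t [s_ge0 At Bt]]] := polar_coordinates A B.
have := t0_max t; rewrite At Bt.
have := cos2Dsin2 t; have := cos2Dsin2 t0.
set c := cos t; set d := sin t; set c0 := cos t0; set d0 := sin t0 => e0 e1 le.
case: (eqVneq s 0) => [->|s0]; first by rewrite !mul0r.
have s_gt0 : 0 < s by rewrite lt_def s0.
have {}le : c * c0 + d * d0 >= 1.
  rewrite -(ler_pM2l s_gt0); nra.
suff : (c * d0 - d * c0) ^+ 2 = 0.
  by move/eqP; rewrite sqrf_eq0 subr_eq0 -!mulrA => /eqP ->.
apply/eqP; rewrite eq_le sqr_ge0 andbT.
have -> : (c * d0 - d * c0) ^+ 2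
   = (c ^+ 2 + d ^+ 2) * (c0 ^+ 2 + d0 ^+ 2) - (c * c0 + d * d0) ^+ 2 by ring.
rewrite e0 e1; nra.
Qed.

Definition shifted_ratio (R : realType) (theta a b y : R) : R :=
  (a + b * cos (y + theta)) / (a + b * cos (y - theta)).

Lemma sinusoid_gt0 (R : realType) (a b y : R) : `|b| < a -> 0 < a + b * cos y.
Proof.
move=> ltba; have : `|b * cos y| < a.
  rewrite normrM (le_lt_trans _ ltba) // ler_piMr // ler_norml cos_geN1.
  exact: cos_le1.
by rewrite ltr_norml => /andP[]; lra.
Qed.

Lemma shifted_ratioN (R : realType) (theta a b y : R) :
  shifted_ratio theta a b (- y) = (shifted_ratio theta a b y)^-1.
Proof.
rewrite /shifted_ratio invf_div.
have -> : - y + theta = - (y - theta) by ring.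
have -> : - y - theta = - (y + theta) by ring.
by rewrite !cosN.
Qed.

(* With H the maximum, a + b cos(y + theta) - H (a + b cos(y - theta)) is a
   constant plus a sinusoid, and it is also maximal at y0: no derivative of the
   quotient is needed. *)
Lemma shifted_ratio_max_cos (R : realType) (theta a b y0 : R) :
  `|b| < a -> sin theta != 0 ->
  (forall y, shifted_ratio theta a b y <= shifted_ratio theta a b y0) ->
  b * (a * cos y0 + b * cos theta) = 0.
Proof.
move=> ltba sin_theta y0_max; set H := shifted_ratio theta a b y0.
have g_gt0 y := sinusoid_gt0 y ltba.
have eH : a + b * cos (y0 + theta) = H * (a + b * cos (y0 - theta)).
  by rewrite /H /shifted_ratio divfK // gt_eqF.
have leH t : a + b * cos (t + theta) <= H * (a + b * cos (t - theta)).
  by rewrite -ler_pdivrMr //; exact: y0_max.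
(* These are the coefficients of cos t and sin t in the expansion of the difference between the two
   sides of [leH]. *)
have : b * cos theta * (1 - H) * sin y0 = - b * sin theta * (1 + H) * cos y0.
  apply: sinusoid_max => t.
  by have := leH t; move: eH; rewrite !cosD !(cosN, sinN); lra.
move=> /eqP; rewrite -subr_eq0 => /eqP E.
(* Multiplying by the denominator of [H] eliminates [H] through [eH]. *)
have : (a + b * cos (y0 - theta)) * 0 = 0 by rewrite mulr0.
rewrite -[X in _ * X]E.
have -> : (a + b * cos (y0 - theta)) *
   (b * cos theta * (1 - H) * sin y0 - - b * sin theta * (1 + H) * cos y0) =
   b * cos theta *
     ((a + b * cos (y0 - theta)) - (a + b * cos (y0 + theta))) * sin y0 +
   b * sin theta *
     ((a + b * cos (y0 - theta)) + (a + b * cos (y0 + theta))) * cos y0.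
  by rewrite eH; ring.
rewrite !cosD !(cosN, sinN); set c := cos y0; set d := sin y0 => E2.
have e1 : c ^+ 2 + d ^+ 2 = 1 by exact: cos2Dsin2.
apply: (mulfI sin_theta); rewrite mulr0.
(* Inserting c^2 + d^2 = 1 here makes the goal one half of [E2], hence a linear consequence of
   it. *)
have -> : sin theta * (b * (a * c + b * cos theta)) =
  sin theta * (b * (a * c + b * cos theta * (c ^+ 2 + d ^+ 2))).
  by rewrite e1 mulr1.
by lra.
Qed.

Lemma shifted_ratio_gt0 (R : realType) (theta a b y : R) :
  `|b| < a -> 0 < shifted_ratio theta a b y.
Proof. by move=> ltba; rewrite divr_gt0 // sinusoid_gt0. Qed.

(** The opposite of a minimizer is a maximizer, so for b <> 0 the critical equation gives both
    points the same cosine. If their sines agree too, the function is constant, equal to its value 1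
    at 0; if the sines are opposite, the half-sum has zero sine, and there numerator and denominator
    coincide. *)
Lemma shifted_ratio_midpoint (R : realType) (theta a b ymin ymax : R) :
  `|b| < a -> sin theta != 0 ->
  (forall y, shifted_ratio theta a b ymin <= shifted_ratio theta a b y) ->
  (forall y, shifted_ratio theta a b y <= shifted_ratio theta a b ymax) ->
  shifted_ratio theta a b ((ymin + ymax) / 2) = 1.
Proof.
move=> ltba sin_theta hmin hmax.
have h_gt0 y : 0 < shifted_ratio theta a b y by exact: shifted_ratio_gt0.
have hpi y : sin y = 0 -> shifted_ratio theta a b y = 1.
  move=> sy; rewrite /shifted_ratio !cosD !(cosN, sinN) sy !mul0r !subr0 divff //.
  by have := sinusoid_gt0 (y + theta) ltba; rewrite cosD sy mul0r subr0 => /lt0r_neq0.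
have hcst : shifted_ratio theta a b ymin = shifted_ratio theta a b ymax ->
    shifted_ratio theta a b ((ymin + ymax) / 2) = 1.
  move=> hE; rewrite -(hpi 0) ?sin0 //.
  have hc y : shifted_ratio theta a b y = shifted_ratio theta a b ymax.
    by apply/eqP; rewrite eq_le hmax -hE hmin.
  by rewrite hc -(hc 0).
case: (eqVneq b 0) => [b0|b_neq0].
  by apply: hcst; rewrite /shifted_ratio b0 !mul0r.
have cmax := shifted_ratio_max_cos ltba sin_theta hmax.
have cmin : b * (a * cos ymin + b * cos theta) = 0.
  rewrite -(cosN ymin); apply: shifted_ratio_max_cos => // y.
  by rewrite shifted_ratioN -[leLHS]invrK -shifted_ratioN lef_pV2 ?posrE.
have a_neq0 : a != 0 by rewrite gt_eqF // (le_lt_trans _ ltba).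
have ecos : cos ymin = cos ymax.
  apply: (mulfI a_neq0); apply: (addIr (b * cos theta)).
  by apply: (mulfI b_neq0); rewrite cmin cmax.
have : sin ymin ^+ 2 = sin ymax ^+ 2 by rewrite !sin2cos2 ecos.
move/eqP; rewrite eqf_sqr => /orP[] /eqP esin.
  by apply: hcst; rewrite /shifted_ratio !cosD !(cosN, sinN) ecos esin.
apply: hpi; apply/eqP; rewrite -sqrf_eq0; apply/eqP.
(* With equal cosines and opposite sines, cos (ymin + ymax) = cos^2 + sin^2. *)
have : cos ((ymin + ymax) / 2 *+ 2) = 1.
  rewrite -mulr_natr divfK // cosD esin ecos.
  by rewrite mulNr opprK -!expr2 cos2Dsin2.
by rewrite cos_mulr2n sin2cos2; lra.
Qed.

Lemma ratio_profileE (R : realType) (rho theta a b vphi x : R) : `|b| < a ->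
  ratio_profile rho theta a b vphi x = rho ^+ 2 *
    ((a + b * cos (2 * (x + 1) * theta + vphi)) /
     (a + b * cos (2 * x * theta + vphi))).
Proof.
move=> ltba; rewrite /ratio_profile; congr (_ * _).
have := lt0r_neq0 (sinusoid_gt0 (2 * x * theta + vphi) ltba).
by set c := cos _; set d := cos _ => g_neq0; field.
Qed.

Lemma ratio_profile_shifted (R : realType) (rho theta a b vphi x : R) :
  `|b| < a -> ratio_profile rho theta a b vphi x =
  rho ^+ 2 * shifted_ratio theta a b ((2 * x + 1) * theta + vphi).
Proof.
move=> ltba; rewrite ratio_profileE // /shifted_ratio.
by congr (_ * ((a + b * cos _) / (a + b * cos _))); ring.
Qed.

(** The change of variable y = (2x + 1) theta + vphi is affine and onto, so it carries extremizers
    to extremizers and midpoints to midpoints. *)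
Lemma ratio_profile_midpoint (R : realType) (rho theta a b vphi xmin xmax : R) :
  0 < rho -> `|b| < a -> sin theta != 0 ->
  let phi := ratio_profile rho theta a b vphi in
  (forall x, phi xmin <= phi x) -> (forall x, phi x <= phi xmax) ->
  rho = Num.sqrt (phi ((xmin + xmax) / 2)).
Proof.
move=> rho_gt0 ltba sin_theta phi hmin hmax.
have theta_neq0 : theta != 0 by apply: contraNneq sin_theta => ->; rewrite sin0.
have surj y : exists x, y = (2 * x + 1) * theta + vphi.
  by exists (((y - vphi) / theta - 1) / 2); field.
rewrite /phi ratio_profile_shifted //.
have -> : (2 * ((xmin + xmax) / 2) + 1) * theta + vphi =
   (((2 * xmin + 1) * theta + vphi) + ((2 * xmax + 1) * theta + vphi)) / 2.
  by field.
rewrite shifted_ratio_midpoint // ?mulr1 ?sqrtr_sqr ?gtr0_norm // => y.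
  have [x ->] := surj y; have := hmin x.
  by rewrite /phi !ratio_profile_shifted // ler_pM2l // exprn_gt0.
have [x ->] := surj y; have := hmax x.
by rewrite /phi !ratio_profile_shifted // ler_pM2l // exprn_gt0.
Qed.

Lemma ratio_profile_periodic (R : realType) (rho theta a b vphi : R) :
  sin theta != 0 ->
  exists2 T : R, 0 < T & periodic (ratio_profile rho theta a b vphi) T.
Proof.
move=> sin_theta.
have theta_neq0 : theta != 0 by apply: contraNneq sin_theta => ->; rewrite sin0.
(* The variable enters only through 2 x theta; the absolute value keeps the period positive for a
   negative argument. *)
exists (pi / `|theta|); first by rewrite divr_gt0 ?pi_gt0 ?normr_gt0.
have cosT y : cos (y + 2 * (pi / `|theta|) * theta) = cos y.
  have [theta_gt0|theta_lt0|theta0] := ltrgt0P theta.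
  - by rewrite mulrA divfK // mulr_natl cosD2pi.
  - rewrite -[LHS]cosD2pi.
    have -> : 2 * (pi / - theta) * theta = - (pi *+ 2) by rewrite -mulr_natl; field.
    by rewrite subrK.
  - by rewrite theta0 eqxx in theta_neq0.
move=> x; rewrite /ratio_profile.
have -> : 2 * (x + pi / `|theta| + 1) * theta + vphi =
  2 * (x + 1) * theta + vphi + 2 * (pi / `|theta|) * theta by ring.
have -> : 2 * (x + pi / `|theta|) * theta + vphi =
  2 * x * theta + vphi + 2 * (pi / `|theta|) * theta by ring.
by rewrite !cosT.
Qed.

(** * Geometric bounds for complex linear recurrences *)

(** An auxiliary norm in which the errors are estimated; [dot_l1norm] transfers the estimates to the
    given inner product. *)
Definition l1norm (R : realType) n (x : 'cV[R[i]]_n) : R :=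
  \sum_i cmod (x i 0).

Section L1Norm.
Context {R : realType} {n : nat}.
Implicit Types x y : 'cV[R[i]]_n.

Lemma cmod_ge0 (z : R[i]) : 0 <= cmod z.
Proof. by case: z => a b; exact: sqrtr_ge0. Qed.

Lemma cmodM (z z' : R[i]) : cmod (z * z') = cmod z * cmod z'.
Proof. exact: ComplexField.Normc.normcM. Qed.

Lemma cmod_real (a : R) : cmod a%:C = `|a|.
Proof. by rewrite /cmod /= expr0n /= addr0 sqrtr_sqr. Qed.

Lemma l1norm_ge0 x : 0 <= l1norm x.
Proof. by apply: sumr_ge0 => i _; exact: cmod_ge0. Qed.

Lemma l1norm0 : l1norm (0 : 'cV[R[i]]_n) = 0.
Proof. by apply: big1 => i _; rewrite mxE; exact: ComplexField.Normc.normc0. Qed.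

Lemma l1normD x y : l1norm (x + y) <= l1norm x + l1norm y.
Proof.
rewrite /l1norm -big_split /=; apply: ler_sum => i _.
by rewrite mxE; exact: le_normcD.
Qed.

Lemma l1normZ (z : R[i]) x : l1norm (z *: x) = cmod z * l1norm x.
Proof. by rewrite /l1norm mulr_sumr; apply: eq_bigr => i _; rewrite mxE cmodM. Qed.

End L1Norm.

(** The rank [K] matters when r = 0: the bound then says that the sequence is eventually zero, as
    happens on a nilpotent part. *)
Definition geometric_bound (R : realType) n (r : R) (x : nat -> 'cV[R[i]]_n) :=
  exists C K, forall k, (K <= k)%N -> l1norm (x k) <= C * r ^+ k.

Section LinearRecurrence.
Context {R : realType} {n : nat}.
Implicit Types (A : 'M[R[i]]_n) (x y : nat -> 'cV[R[i]]_n) (r : R) (mu : R[i]).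

Lemma geometric_boundD r x y : 0 <= r ->
  geometric_bound r x -> geometric_bound r y ->
  geometric_bound r (fun k => x k + y k).
Proof.
move=> r_ge0 [C [K xC]] [D [L yD]]; exists (C + D), (maxn K L) => k.
rewrite geq_max => /andP[Kk Lk]; rewrite mulrDl.
by rewrite (le_trans (l1normD _ _)) // lerD ?xC ?yD.
Qed.

Lemma geometric_bound_eigen A mu x :
  (forall k, x k.+1 = A *m x k) -> A *m x 0%N = mu *: x 0%N ->
  geometric_bound (cmod mu) x.
Proof.
move=> x_rec x0_eigen; exists (l1norm (x 0%N)), 0%N => k _.
suff [-> _] : l1norm (x k) = l1norm (x 0%N) * cmod mu ^+ k /\
              A *m x k = mu *: x k by [].
elim: k => [|k [IHk eigen]]; first by rewrite mulr1.
by rewrite x_rec eigen l1normZ IHk -scalemxAr eigen exprS mulrCA.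
Qed.

Lemma geometric_bound_lower mu r x y :
  cmod mu < r \/ r = 0 /\ mu = 0 ->
  (forall k, x k.+1 = mu *: x k + y k) ->
  geometric_bound r y -> geometric_bound r x.
Proof.
move=> [mu_lt|[-> ->]] x_rec [C [K yC]]; last first.
  (* Here x (k+1) = y k, whose bound C * 0^k vanishes only for k >= 1. *)
  exists 0, (maxn K 1).+1 => -[//|k]; rewrite ltnS geq_max => /andP[Kk k_gt0].
  by rewrite x_rec scale0r add0r (le_trans (yC _ Kk)) // expr0n gtn_eqF // mulr0 mul0r.
have r_gt0 : 0 < r by rewrite (le_lt_trans (cmod_ge0 mu)).
have d_gt0 : 0 < r - cmod mu by rewrite subr_gt0.
(* The first term starts the induction at [K]; the second gives |mu| D + C <= D r, which propagates
   it. *)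
pose D := Num.max (l1norm (x K) / r ^+ K) (C / (r - cmod mu)).
exists D, K => k /subnK <-; elim: (k - K)%N => [|j IHj].
  by rewrite add0n -ler_pdivrMr ?exprn_gt0 // le_max lexx.
rewrite addSn x_rec (le_trans (l1normD _ _)) // l1normZ.
have CD : C <= D * (r - cmod mu) by rewrite -ler_pdivrMr // le_max lexx orbT.
have -> : D * r ^+ (j + K).+1 = cmod mu * (D * r ^+ (j + K)) +
    D * (r - cmod mu) * r ^+ (j + K) by rewrite exprS; ring.
rewrite lerD ?ler_wpM2l ?cmod_ge0 // (le_trans (yC _ (leq_addl _ _))) //.
by rewrite ler_wpM2r // exprn_ge0 // ltW.
Qed.

Lemma comm_shift A (B : 'M[R[i]]_n) mu :
  GRing.comm B A -> GRing.comm B (A - mu%:M).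
Proof.
by move=> comBA; apply: commrB => //; rewrite /GRing.comm -!mulmxE scalar_mxC.
Qed.

Lemma comm_prod_shift A (B : 'M[R[i]]_n) (s : seq R[i]) : GRing.comm B A ->
  B *m (\prod_(z <- s) (A - z%:M)) = (\prod_(z <- s) (A - z%:M)) *m B.
Proof.
by move=> comBA; rewrite !mulmxE; apply: commr_prod => z _; exact: comm_shift.
Qed.

Lemma prod_shift_eigen A mu (s : seq R[i]) (v : 'cV[R[i]]_n) :
  A *m v = mu *: v ->
  (\prod_(z <- s) (A - z%:M)) *m v = (\prod_(z <- s) (mu - z)) *: v.
Proof.
move=> v_eigen; elim: s => [|z s IHs]; first by rewrite !big_nil mul1mx scale1r.
rewrite !big_cons -mulmxA IHs -scalemxAr mulmxBl v_eigen mul_scalar_mx.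
by rewrite -scalerBl scalerA mulrC.
Qed.

(* Induction on the roots mu :: s.  If |mu| < r or mu = r = 0, the sequence
   (A - mu) x has roots s and drives x by a contracting recurrence.  Otherwise
   |mu| = r: if mu is in s, semisimplicity makes one copy of mu redundant; if
   not, subtracting the eigencomponent of x along mu leaves the roots s. *)
Lemma geometric_bound_roots A r (s : seq R[i]) x :
  (forall z, z \in s -> cmod z <= r) ->
  (forall z, z \in s -> cmod z = r -> z != 0 -> semisimple_eigenvalue A z) ->
  (forall k, x k.+1 = A *m x k) ->
  (\prod_(z <- s) (A - z%:M)) *m x 0%N = 0 ->
  geometric_bound r x.
Proof.
have shift_rec (B : 'M[R[i]]_n) y : B *m A = A *m B ->
    (forall k, y k.+1 = A *m y k) -> forall k, B *m y k.+1 = A *m (B *m y k).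
  by move=> comBA y_rec k; rewrite y_rec !mulmxA comBA.
have comAA : GRing.comm A A by [].
elim: s x => [|mu s IHs] x s_le s_semisimple x_rec.
  rewrite big_nil mul1mx => x0; exists 0, 0%N => k _.
  suff -> : x k = 0 by rewrite l1norm0 mul0r.
  by elim: k => // k IHk; rewrite x_rec IHk mulmx0.
rewrite big_cons -mulmxA => x0.
have {}IHs y : (forall k, y k.+1 = A *m y k) ->
    (\prod_(z <- s) (A - z%:M)) *m y 0%N = 0 -> geometric_bound r y.
  apply: IHs => z zs; first by apply: s_le; rewrite inE zs orbT.
  by apply: s_semisimple; rewrite inE zs orbT.
have r_ge0 : 0 <= r.
  by rewrite (le_trans (cmod_ge0 mu)) // s_le ?inE ?eqxx.
pose B := \prod_(z <- s) (A - z%:M).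
have comAmu : GRing.comm (A - mu%:M) A by apply/commr_sym/comm_shift.
have comB : B *m A = A *m B by rewrite comm_prod_shift.
have comBmu : B *m (A - mu%:M) = (A - mu%:M) *m B by rewrite comm_prod_shift.
have [low|[mur mu_neq0]] : (cmod mu < r \/ r = 0 /\ mu = 0) \/ cmod mu = r /\ mu != 0.
  have := s_le mu; rewrite inE eqxx le_eqVlt => /(_ isT) /predU1P[<-|]; last by left; left.
  have [->|mu_neq0] := eqVneq mu 0; last by right.
  by left; right; rewrite /cmod ComplexField.Normc.normc0.
  apply: (geometric_bound_lower low (y := fun k => (A - mu%:M) *m x k)).
    by move=> k; rewrite x_rec mulmxBl mul_scalar_mx addrC subrK.
  apply: IHs => [k|]; first exact: shift_rec.
  by rewrite mulmxA comBmu -mulmxA.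
have mu_semisimple : semisimple_eigenvalue A mu.
  by apply: s_semisimple; rewrite ?inE ?eqxx.
have [mus|mus] := boolP (mu \in s).
  apply: IHs => //; have [s1 [s2 sE]] : exists s1 s2, s = s1 ++ mu :: s2.
    by clear -mus; case/splitPr: mus => s1 s2; exists s1, s2.
  (* Moving one factor A - mu to the front of B turns (A - mu) B x0 = 0 into (A - mu)^2 B1 B2 x0 =
     0, and semisimplicity drops one factor. *)
  pose B1 := \prod_(z <- s1) (A - z%:M); pose B2 := \prod_(z <- s2) (A - z%:M).
  have BE : B = (A - mu%:M) *m (B1 *m B2).
    rewrite /B sE big_cat big_cons /= -/B1 -/B2 -!mulmxE.
    by rewrite !mulmxA; congr (_ *m _); rewrite [RHS]comm_prod_shift.
  rewrite -/B BE -mulmxA; apply: mu_semisimple.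
  by rewrite [X in _ *m X]mulmxA -BE.
pose p := \prod_(z <- s) (mu - z).
have p_neq0 : p != 0.
  rewrite /p prodf_seq_neq0; apply/allP => z zs /=; rewrite subr_eq0.
  by apply: contraNneq mus => ->.
(* B x0 lies in the eigenspace of mu, where B acts as the scalar p. Dividing by p makes B e0 = B x0,
   so that B kills x0 - e0. *)
pose e k := p^-1 *: (B *m x k).
have e0_eigen : A *m e 0%N = mu *: e 0%N.
  move/eqP: x0; rewrite mulmxBl mul_scalar_mx subr_eq0 => /eqP x0.
  by rewrite /e -scalemxAr x0 !scalerA mulrC.
have e_rec k : e k.+1 = A *m e k by rewrite /e shift_rec // -scalemxAr.
have xe_bound : geometric_bound r (fun k => x k - e k).
  apply: IHs => [k|]; first by rewrite x_rec e_rec mulmxBr.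
  rewrite mulmxBr (prod_shift_eigen _ e0_eigen) -/p /e scalerA divff // scale1r.
  exact: subrr.
have e_bound : geometric_bound r e by rewrite -mur; exact: geometric_bound_eigen e_rec _.
have := geometric_boundD r_ge0 xe_bound e_bound.
by congr geometric_bound; apply/funext => k; rewrite subrK.
Qed.

End LinearRecurrence.

(** * Rotation on an ellipse and its inner products *)

(** The real part of e^(it) (p + iq). *)
Definition rotating (R : realType) n (p q : 'cV[R]_n) (t : R) : 'cV[R]_n :=
  cos t *: p - sin t *: q.

Section Rotating.
Context {R : realType} {n : nat}.
Implicit Types p q x y : 'cV[R]_n.

Lemma rotatingD p q t s :
  rotating p q (t + s) =
  cos s *: rotating p q t - sin s *: (sin t *: p + cos t *: q).
Proof.
by apply/colP => i; rewrite !mxE cosD sinD; ring.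
Qed.

(** The vector sin t p + cos t q is the imaginary part of e^(it) (p + iq). Two zeros of the real
    part at angles differing by s kill both parts, and the rotation by t is invertible. *)
Lemma rotating_eq0 p q t s : sin s != 0 ->
  rotating p q t = 0 -> rotating p q (t + s) = 0 -> p = 0 /\ q = 0.
Proof.
move=> sin_s w0; rewrite rotatingD w0 scaler0 sub0r => /eqP.
rewrite oppr_eq0 scaler_eq0 (negPf sin_s) /= => /eqP w1.
have cs := cos2Dsin2 t; split; apply/colP => i.
  have -> : p = cos t *: rotating p q t + sin t *: (sin t *: p + cos t *: q).
    by apply/colP => j; rewrite !mxE -[LHS]mul1r -cs; ring.
  by rewrite w0 w1 !scaler0 addr0.
have -> : q = cos t *: (sin t *: p + cos t *: q) - sin t *: rotating p q t.
  by apply/colP => j; rewrite !mxE -[LHS]mul1r -cs; ring.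
by rewrite w0 w1 !scaler0 subr0.
Qed.

(** The hypotheses are the real and imaginary parts of M (p + iq) = rho e^(i theta) (p + iq). *)
Lemma rotating_mulmx (M : 'M[R]_n) p q rho theta t :
  M *m p = (rho * cos theta) *: p - (rho * sin theta) *: q ->
  M *m q = (rho * sin theta) *: p + (rho * cos theta) *: q ->
  M *m rotating p q t = rho *: rotating p q (t + theta).
Proof.
move=> Mp Mq; rewrite /rotating mulmxBr -!scalemxAr Mp Mq.
by apply/colP => i; rewrite !mxE cosD sinD; ring.
Qed.

Context (ip : {dot 'cV[R]_n for idfun}).

Lemma dotC x y : ip x y = ip y x.
Proof. by rewrite (hermC ip) /= expr0 mul1r. Qed.

Lemma dot_ge0 x : 0 <= ip x x.
Proof.
have [->|x_neq0] := eqVneq x 0; first by rewrite linear0l.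
by rewrite ltW // neq0_dnorm_gt0.
Qed.

Lemma dotDD x y : ip (x + y) (x + y) = ip x x + 2 * ip x y + ip y y.
Proof. by rewrite linearDl !linearDr /= (dotC y x); ring. Qed.

Lemma dot_rotating p q : exists a b vphi, [/\ 0 <= b &
  forall t, 2 * ip (rotating p q t) (rotating p q t) =
            a + b * cos (2 * t + vphi)].
Proof.
(* Twice the squared norm is |p|^2 + |q|^2 + (|p|^2 - |q|^2) cos 2t - 2 <p,q> sin 2t; polar
   coordinates merge the last two terms. *)
have [b [vphi [b_ge0 bc bs]]] := polar_coordinates (ip p p - ip q q) (2 * ip p q).
exists (ip p p + ip q q), b, vphi; split=> // t.
have -> : 2 * t = t *+ 2 by rewrite mulr_natl.
rewrite cosD cos_mulr2n sin_mulr2n.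
have s2 := sin2cos2 t.
rewrite /rotating linearBl !linearBr /= !(linearZl_LR ip) !(linearZr_LR ip) /= (dotC q p).
move: bc bs s2; set c := cos t; set s := sin t => ebc ebs s2.
have ebc2 := congr1 (fun z => z * c ^+ 2) ebc.
have ebs2 := congr1 (fun z => z * (c * s)) ebs.
by have s2Q := congr1 (fun z => z * ip q q) s2; move: ebc2 ebs2 s2Q => /=; lra.
Qed.

(** Continuity of the inner product; the constant is the sum of the absolute values of its Gram
    matrix in the canonical basis. *)
Lemma dot_l1norm : exists2 D, 0 <= D &
  forall x y, `|ip x y| <= D * l1norm (cplx_mx x) * l1norm (cplx_mx y).
Proof.
pose e (i : 'I_n) : 'cV[R]_n := delta_mx i 0.
have decomp x : x = \sum_i x i 0 *: e i.
  by rewrite {1}[x]matrix_sum_delta; apply: eq_bigr => i _; rewrite big_ord1.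
have le_l1 x i : `|x i 0| <= l1norm (cplx_mx x).
  rewrite /l1norm (bigD1 i) //= mxE cmod_real lerDl.
  by apply: sumr_ge0 => j _; exact: cmod_ge0.
exists (\sum_i \sum_j `|ip (e i) (e j)|).
  by apply: sumr_ge0 => i _; apply: sumr_ge0.
move=> x y; rewrite {1}(decomp x) {1}(decomp y) linear_sumlz.
rewrite !mulr_suml (le_trans (ler_norm_sum _ _ _)) //; apply: ler_sum => i _.
rewrite linear_sumr !mulr_suml (le_trans (ler_norm_sum _ _ _)) //.
apply: ler_sum => j _; rewrite linearZl_LR linearZr_LR /= !normrM.
rewrite [leLHS]mulrA [leLHS]mulrC -[leRHS]mulrA.
by rewrite ler_wpM2l // ler_pM.
Qed.

End Rotating.

(** * Quotients of perturbed sequences *)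

Lemma geometric_lt (R : realType) (q E m : R) : 0 <= q < 1 -> 0 < m ->
  exists K, forall k, (K <= k)%N -> E * q ^+ k <= m.
Proof.
move=> /andP[q_ge0 q_lt1] m_gt0.
have : E * q ^+ k @[k --> \oo] --> E * 0.
  by apply: cvgMr; apply: cvg_expr; rewrite ger0_norm.
rewrite mulr0 => /cvgr_le /(_ _ m_gt0)[K _ HK].
by exists K => k Kk; exact: HK.
Qed.

Lemma ratio_geometric (R : realType) (q E m B : R) (U g : nat -> R) (K : nat) :
  0 <= q < 1 -> 0 < m -> (forall k, m <= g k <= B) ->
  (forall k, (K <= k)%N -> `|U k - g k| <= E * q ^+ k) ->
  exists E' K', forall k, (K' <= k)%N ->
    `|U k.+1 / U k - g k.+1 / g k| <= E' * q ^+ k.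
Proof.
move=> q01 m_gt0 gmB UE; have /andP[q_ge0 q_lt1] := q01.
have m2_gt0 : 0 < m / 2 by rewrite divr_gt0.
have [L HL] := geometric_lt E q01 m2_gt0.
(* Over the common denominator U_k g_k, the numerator is at most 2 E B q^k. From rank [L] on the
   error is at most m / 2, so the denominator is at least (m / 2) m. *)
exists (2 * E * B / (m / 2 * m)), (maxn K L) => k; rewrite geq_max => /andP[Kk Lk].
have /andP[mg gB] := gmB k; have /andP[mg1 gB1] := gmB k.+1.
have g_gt0 : 0 < g k by rewrite (lt_le_trans m_gt0).
have B_ge0 : 0 <= B by rewrite ltW // (lt_le_trans g_gt0).
have Uk := UE _ Kk; have Uk1 := UE _ (leqW Kk).
have Um : m / 2 <= U k.
  have := le_trans Uk (HL _ Lk); rewrite ler_norml => /andP[]; lra.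
have U_gt0 : 0 < U k by rewrite (lt_le_trans m2_gt0).
have Eq_ge0 : 0 <= E * q ^+ k by rewrite (le_trans _ Uk).
have Eq1 : E * q ^+ k.+1 <= E * q ^+ k.
  by rewrite exprS mulrCA ler_piMl // ltW.
have -> : U k.+1 / U k - g k.+1 / g k =
   ((U k.+1 - g k.+1) * g k - g k.+1 * (U k - g k)) / (U k * g k).
  by field; rewrite !gt_eqF.
have -> : 2 * E * B / (m / 2 * m) * q ^+ k =
   (E * q ^+ k * B + B * (E * q ^+ k)) / (m / 2 * m) by field; rewrite gt_eqF.
rewrite normrM normfV (gtr0_norm (mulr_gt0 U_gt0 g_gt0)).
apply: ler_pM; rewrite ?invr_ge0 ?(ltW (mulr_gt0 U_gt0 g_gt0)) //.
  rewrite (le_trans (ler_normB _ _)) // !normrM lerD // ler_pM //.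
  - exact: le_trans Eq1.
  - by rewrite gtr0_norm.
  - by rewrite gtr0_norm // (lt_le_trans m_gt0).
by rewrite lef_pV2 ?posrE ?mulr_gt0 // ler_pM //; exact: ltW.
Qed.

Lemma eqaddO_nat (R : realType) (f g e : nat -> R) (C : R) (K : nat) :
  (forall k, (K <= k)%N -> `|f k - g k| <= C * e k) ->
  (f : nat -> R^o) = (g : nat -> R^o) +O_\oo (e : nat -> R^o).
Proof.
move=> fgC; apply/eqaddOP; exists `|C|; split=> [|D ltCD]; first exact: num_real.
exists K => //= k Kk; apply: le_trans (fgC _ Kk) _.
by rewrite (le_trans (ler_norm _)) // normrM ler_wpM2r // ltW.
Qed.

(** * Passage between real and complex vectors *)

Lemma l1norm_real (R : realType) n (x : 'cV[R]_n) :
  l1norm (cplx_mx x) = \sum_i `|x i 0|.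
Proof. by apply: eq_bigr => i _; rewrite mxE cmod_real. Qed.

Lemma l1norm_rotating (R : realType) n (p q : 'cV[R]_n) t :
  l1norm (cplx_mx (rotating p q t)) <= l1norm (cplx_mx p) + l1norm (cplx_mx q).
Proof.
rewrite !l1norm_real -big_split; apply: ler_sum => i _ /=; rewrite !mxE.
rewrite (le_trans (ler_normB _ _)) // !normrM lerD // ler_piMl //.
  by rewrite ler_norml cos_geN1 cos_le1.
by rewrite ler_norml sin_geN1 sin_le1.
Qed.

Lemma twice_Re (R : realType) (z : R[i]) :
  (complex.Re (2 * z))%:C = z + conjc z.
Proof.
rewrite addcJ; case: z => a b; apply/eqP; rewrite eq_complex /=.
by apply/andP; split; apply/eqP; ring.
Qed.

Lemma complex_eigen_real (R : realType) n (M : 'M[R]_n) (mu : R[i])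
    (z : 'cV[R[i]]_n) :
  let p := map_mx (@complex.Re R) z in let q := map_mx (@complex.Im R) z in
  cplx_mx M *m z = mu *: z ->
  M *m p = complex.Re mu *: p - complex.Im mu *: q /\
  M *m q = complex.Im mu *: p + complex.Re mu *: q.
Proof.
move=> p q /colP z_eigen; split; apply/colP => i; have := z_eigen i; rewrite !mxE.
  have <- : complex.Re (mu * z i 0) =
      complex.Re mu * complex.Re (z i 0) - complex.Im mu * complex.Im (z i 0).
    by clear z_eigen; case: mu (z i 0) => [a b] [c d].
  move=> <-; rewrite raddf_sum; apply: eq_bigr => j _ /=.
  by rewrite !mxE; case: (z j 0) => c d /=; ring.
have <- : complex.Im (mu * z i 0) =
    complex.Im mu * complex.Re (z i 0) + complex.Re mu * complex.Im (z i 0).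
  by clear z_eigen; case: mu (z i 0) => [a b] [c d] /=; ring.
move=> <-; rewrite raddf_sum; apply: eq_bigr => j _ /=.
by rewrite !mxE; case: (z j 0) => c d /=; ring.
Qed.

(** * Asymptotics of the ratio of squared norms *)

Theorem proposition2 (R : realType) (N : nat) (M : 'M[R]_N)
  (lam : N.-tuple R[i])
  (lam_eigenvalues : char_poly (cplx_mx M) = \prod_(z <- lam) ('X - z%:P))
  (lam0_nonreal : complex.Im lam`_0 != 0)
  (lam1_conj : lam`_1 = (lam`_0)^*)
  (zeta : 'cV[R[i]]_N)
  (zeta_neq0 : zeta != 0)
  (zeta_eigenvector : cplx_mx M *m zeta = lam`_0 *: zeta)
  (lam0_dominant : forall j, (2 <= j < N)%N -> cmod lam`_j < cmod lam`_0)
  (lam2_largest : forall j, (2 <= j < N)%N -> cmod lam`_j <= cmod lam`_2)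
  (lam2_semisimple : forall j, (2 <= j < N)%N ->
     cmod lam`_j = cmod lam`_2 -> lam`_j != 0 ->
     semisimple_eigenvalue (cplx_mx M) lam`_j)
  (u : nat -> 'cV[R]_N)
  (u_rec : forall k, u k.+1 = M *m u k)
  (u0_generic : excites_dominant_pair (cplx_mx M) lam zeta (u 0%N))
  (theta : R)
  (theta_arg : is_argument lam`_0 theta)
  (nrm : 'cV[R]_N -> R)
  (nrm_hilbertian : hilbertian_norm nrm) :
  exists a b vphi : R,
    let phi : R -> R := ratio_profile (cmod lam`_0) theta a b vphi in
    [/\ forall x : R, a + b * cos (2 * x * theta + vphi) != 0,
        (fun k : nat => nrm (u k.+1) ^+ 2 / nrm (u k) ^+ 2 : R^o)
          = (fun k : nat => phi k%:R : R^o)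
            +O_\oo (fun k : nat => cmod (lam`_2 / lam`_0) ^+ k : R^o),
        exists2 T : R, 0 < T & periodic phi T
      & forall xmin xmax : R,
          (forall x, phi xmin <= phi x) -> (forall x, phi x <= phi xmax) ->
          cmod lam`_0 = Num.sqrt (phi ((xmin + xmax) / 2))].
Proof.
set rho := cmod _; set r := cmod lam`_2.
have [Re0 Im0] : complex.Re lam`_0 = rho * cos theta /\
                 complex.Im lam`_0 = rho * sin theta.
  by split; rewrite [in LHS]theta_arg.
have : rho * sin theta != 0 by rewrite -Im0.
rewrite mulf_eq0 negb_or => /andP[rho_neq0 sin_theta].
have rho_gt0 : 0 < rho by rewrite lt_def rho_neq0 cmod_ge0.
have r_lt : r < rho.
  (* When N <= 2 the entry of index 2 is the default value 0, so r = 0. *)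
  have [ltN|leN] := ltnP 2 N; first exact: lam0_dominant.
  by rewrite /r nth_default ?size_tuple // /cmod ComplexField.Normc.normc0.
have r_ge0 : 0 <= r by exact: cmod_ge0.
have [c [v [c_neq0 u0E v_ker]]] := u0_generic.
(* The factor 2 makes the real part of [z] equal to c zeta plus its conjugate, the dominant part of
   u_0. *)
pose z := (2 * c) *: zeta.
have z_eigen : cplx_mx M *m z = lam`_0 *: z.
  by rewrite -scalemxAr zeta_eigenvector !scalerA mulrC.
pose p := map_mx (@complex.Re R) z; pose q := map_mx (@complex.Im R) z.
have [Mp Mq] := complex_eigen_real z_eigen.
rewrite -/p -/q Re0 Im0 in Mp Mq.
pose w k := rotating p q (k%:R * theta).
have w_rec k : M *m w k = rho *: w k.+1.
  by rewrite /w (rotating_mulmx _ Mp Mq) -natr1 mulrDl mul1r.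
(* Removing the dominant part leaves a solution of the same recurrence that starts at [v], which the
   product over the other eigenvalues kills. *)
pose y k := u k - rho ^+ k *: w k.
have y_rec k : y k.+1 = M *m y k.
  by rewrite /y u_rec mulmxBr -scalemxAr w_rec scalerA -exprSr.
have y_bound : geometric_bound r (fun k => cplx_mx (y k)).
  apply: (geometric_bound_roots (A := cplx_mx M)
            (s := [seq lam`_j | j <- index_iota 2 N])).
  - by move=> _ /mapP[j jN ->]; apply: lam2_largest; rewrite -mem_index_iota.
  - by move=> _ /mapP[j jN ->]; apply: lam2_semisimple; rewrite -mem_index_iota.
  - by move=> k; rewrite y_rec /cplx_mx map_mxM.
  - rewrite big_map; suff -> : cplx_mx (y 0%N) = v by [].
    apply: (addIr (c *: zeta + c^* *: conj_mx zeta)).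
    rewrite [RHS]addrC -u0E /y /w /rotating mul0r cos0 sin0 !scale1r scale0r subr0.
    rewrite /cplx_mx map_mxB -[RHS](subrK (map_mx (real_complex R) p)); congr (_ + _).
    apply/colP => i; rewrite !mxE -mulrA twice_Re.
    by congr (_ + _); exact/esym/(rmorphM (@conjc R)).
(* A zero at angle t is sent by [M] to a zero at t + theta, forcing p = q = 0, hence z = 0, against
   c <> 0 and zeta <> 0. *)
have w_neq0 t : rotating p q t != 0.
  apply: contraNneq zeta_neq0 => w0.
  have := rotating_mulmx t Mp Mq; rewrite w0 mulmx0 => /esym/eqP.
  rewrite scaler_eq0 (negPf rho_neq0) /= => /eqP w1.
  have [p0 q0] := rotating_eq0 sin_theta w0 w1.
  have : z == 0.
    apply/eqP/colP => i; apply/eqP; rewrite eq_complex mxE.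
    move/colP/(_ i): p0; move/colP/(_ i): q0; rewrite !mxE => -> ->.
    by rewrite eqxx.
  by rewrite scaler_eq0 mulf_eq0 (negPf c_neq0) orbF pnatr_eq0.
have [ip nrmE] := nrm_hilbertian.
have nrm2 x : nrm x ^+ 2 = ip x x by rewrite nrmE sqr_sqrtr // dot_ge0.
have [a [b [vphi [b_ge0 gE]]]] := dot_rotating ip p q.
have g_gt0 t : 0 < a + b * cos (2 * t + vphi).
  by rewrite -gE mulr_gt0 // neq0_dnorm_gt0.
have ltba : `|b| < a.
  (* At this angle the cosine is -1, so positivity reads a - b > 0. *)
  have := g_gt0 ((pi - vphi) / 2).
  have -> : 2 * ((pi - vphi) / 2) + vphi = pi by field.
  by rewrite cospi ger0_norm //; lra.
exists a, b, vphi => phi; split.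
- by move=> x; rewrite gt_eqF // sinusoid_gt0.
- have [C [K yC]] := y_bound; have [D D_ge0 ipD] := dot_l1norm ip.
  pose L := l1norm (cplx_mx p) + l1norm (cplx_mx q).
  pose q' := r / rho.
  have q'01 : 0 <= q' < 1.
    rewrite /q' divr_ge0 // ?(ltW rho_gt0) //=.
    by rewrite ltr_pdivrMr // mul1r.
  pose y' k := rho ^- k *: y k.
  have rhok k : 0 < rho ^+ k by rewrite exprn_gt0.
  have uE k : u k = rho ^+ k *: (w k + y' k).
    by rewrite scalerDr scalerA divff ?gt_eqF // scale1r addrC subrK.
  have y'C k : (K <= k)%N -> l1norm (cplx_mx (y' k)) <= `|C| * q' ^+ k.
    move=> Kk; rewrite /cplx_mx /y' map_mxZ /= l1normZ cmod_real.
    rewrite gtr0_norm ?invr_gt0 // mulrC ler_pdivrMr // expr_div_n.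
    rewrite -mulrA divfK ?gt_eqF // (le_trans (yC _ Kk)) //.
    by rewrite ler_wpM2r ?ler_norm // exprn_ge0.
  pose U k := 2 * ip (w k + y' k) (w k + y' k).
  pose g (k : nat) := a + b * cos (2 * (k%:R * theta) + vphi).
  (* The cross term uses |w_k| <= L; the quadratic term is of order q'^(2k), which is at most
     q'^k. *)
  have UgE : forall k, (K <= k)%N ->
      `|U k - g k| <= (4 * (D * L * `|C|) + 2 * (D * `|C| * `|C|)) * q' ^+ k.
    move=> k Kk; have y'k := y'C _ Kk.
    have -> : U k - g k = 4 * ip (w k) (y' k) + 2 * ip (y' k) (y' k).
      by rewrite /U /g -gE dotDD -/(w k); ring.
    have q'k : 0 <= q' ^+ k <= 1.
      case/andP: q'01 => q'_ge0 /ltW q'_le1.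
      by rewrite exprn_ge0 ?exprn_ile1.
    case/andP: q'k => q'k_ge0 q'k_le1.
    rewrite (le_trans (ler_normD _ _)) // !normrM !normr_nat [leRHS]mulrDl.
    rewrite lerD // -[leRHS]mulrA ler_wpM2l //.
      rewrite (le_trans (ipD _ _)) // -!mulrA ler_wpM2l // ler_pM ?l1norm_ge0 //.
      exact: l1norm_rotating.
    rewrite (le_trans (ipD _ _)) // -!mulrA ler_wpM2l //.
    by rewrite ler_pM ?l1norm_ge0 // (le_trans y'k) // ler_piMr.
  have ab_gt0 : 0 < a - b by move: ltba; rewrite ger0_norm // subr_gt0.
  have gb k : a - b <= g k <= a + b.
    rewrite /g; set t := _ + vphi.
    have := ler_wpM2l b_ge0 (cos_geN1 t); have := ler_wpM2l b_ge0 (cos_le1 t).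
    by move=> ? ?; apply/andP; split; lra.
  have [E [K' HE]] := ratio_geometric q'01 ab_gt0 gb UgE.
  apply: (@eqaddO_nat _ _ _ _ (rho ^+ 2 * E) K') => k Kk.
  have -> : nrm (u k.+1) ^+ 2 / nrm (u k) ^+ 2 = rho ^+ 2 * (U k.+1 / U k).
    rewrite !nrm2 !uE !(linearZl_LR ip) !(linearZr_LR ip) /= /U.
    have := rhok k; rewrite exprS; set s := rho ^+ k => s_gt0.
    move: (ip (w k.+1 + _) _) (ip (w k + _) _) => X Y.
    (* With the convention 0^-1 = 0, both quotients are 0 when Y = 0. *)
    case: (eqVneq Y 0) => [->|Y_neq0]; first by rewrite !mulr0 invr0 !mulr0.
    by field; rewrite Y_neq0 gt_eqF.
  have -> : phi k%:R = rho ^+ 2 * (g k.+1 / g k).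
    by rewrite /phi ratio_profileE // /g natr1 !mulrA.
  have -> : cmod (lam`_2 / lam`_0) = q'.
    by rewrite cmodM /q' /cmod ComplexField.Normc.normcV.
  rewrite -mulrBr normrM ger0_norm ?sqr_ge0 // -mulrA ler_wpM2l ?sqr_ge0 //.
  exact: HE.
- exact: ratio_profile_periodic.
- by move=> xmin xmax; exact: ratio_profile_midpoint.
Qed.
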